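(* Let $q$ be a prime power and let $\mathcal{C}$ be an $[n,k]$ linear code over $\mathbb{F}_q$ with diameter $\delta$. If the minimum distance of the dual code $\mathcal{C}^{\perp}$ is at least $2$, then $$n \leq \sum_{i=0}^{k-1} \left\lfloor \frac{\delta}{q^i} \right\rfloor.$$
   Context: An $[n,k]$ linear code over $\mathbb{F}_q$ (with $n$ a positive integer) is a $k$-dimensional $\mathbb{F}_q$-subspace $\mathcal{C}$ of $\mathbb{F}_q^n$. The Hamming weight $\mathrm{wt}(\mathbf{c})$ is the number of nonzero coordinates of $\mathbf{c}$. The diameter of $\mathcal{C}$ is its maximum weight, $\delta=\delta(\mathcal{C})=\max\{\mathrm{wt}(\mathbf{c}) : \mathbf{c}\in\mathcal{C}\}$. The dual code is $\mathcal{C}^\perp=\{\mathbf{x}\in\mathbb{F}_q^n : \sum_{i}x_ic_i=0 \text{ for all } \mathbf{c}\in\mathcal{C}\}$. The condition $d(\mathcal{C}^\perp)\ge 2$ means that $\mathcal{C}^\perp$ contains no vector of weight $1$; equivalently, a generator matrix of $\mathcal{C}$ (a $k\times n$ matrix whose rows form a basis of $\mathcal{C}$) has no zero column. *)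

(* Defs.v *)
From HB Require Import structures.
From mathcomp Require Import all_boot all_order all_algebra all_field.

Set Implicit Arguments.
Unset Strict Implicit.
Unset Printing Implicit Defensive.

Import GRing.Theory.
Local Open Scope ring_scope.

Definition wt (F : finFieldType) (n : nat) (x : 'rV[F]_n) : nat :=
  #|[set i : 'I_n | x 0 i != 0]|.

Definition diameter (F : finFieldType) (n : nat) (C : {vspace 'rV[F]_n}) : nat :=
  \max_(c : 'rV[F]_n | c \in C) wt c.

Definition dual_code (F : finFieldType) (n : nat) (C : {vspace 'rV[F]_n}) :
    {set 'rV[F]_n} :=
  [set x : 'rV[F]_n | [forall (c : 'rV[F]_n | c \in C), \sum_(i < n) x 0 i * c 0 i == 0]].

(* The minimum distance of the linear code D is at least d; the zero code,
   which has no nonzero word, satisfies this for every d. *)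
Definition min_dist_ge (F : finFieldType) (n : nat) (D : {set 'rV[F]_n})
    (d : nat) : Prop :=
  forall x : 'rV[F]_n, x \in D -> x != 0 -> (d <= wt x)%N.

Lemma wt_eq0 (F : finFieldType) (n : nat) (x : 'rV[F]_n) :
  (wt x == 0%N) = (x == 0).
Proof.
rewrite /wt cards_eq0; apply/eqP/eqP => [h | ->].
  apply/rowP => i; rewrite mxE; apply/eqP.
  by have := in_set0 i; rewrite -h inE => /negbFE.
by apply/setP => i; rewrite !inE mxE eqxx.
Qed.

Lemma min_dist_ge2P (F : finFieldType) (n : nat) (D : {set 'rV[F]_n}) :
  min_dist_ge D 2 <-> (forall x : 'rV[F]_n, x \in D -> wt x <> 1%N).
Proof.
split=> [h x xD w1 | h x xD].
  have x0 : x != 0 by rewrite -wt_eq0 w1.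
  by have := h x xD x0; rewrite w1.
by rewrite -wt_eq0; have := h x xD; case: (wt x) => [|[|]].
Qed.

(* Main.v *)
(* Let c be a codeword of maximal weight m and let d be any codeword. Summing
   the weights of the q words d + a c, for a scalar, a coordinate in the support
   of c contributes q - 1 and a coordinate outside it where d is nonzero
   contributes q. Each of these weights is at most m, so d has weight at most
   m / q outside the support of c. Deleting that support leaves a code of length
   n - m, smaller dimension and diameter at most m / q, still without a zero
   coordinate; induct. *)

Require Import Defs.
From HB Require Import structures.
From mathcomp Require Import all_boot all_order all_algebra all_field.

Set Implicit Arguments.
Unset Strict Implicit.
Unset Printing Implicit Defensive.

Import GRing.Theory.

(* Deleting coordinates is modelled by restricting the weight to a set T of
   coordinates, so that the ambient space stays 'rV[F]_n. *)
Definition wt_on (F : finFieldType) (n : nat) (T : {set 'I_n})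
    (x : 'rV[F]_n) : nat :=
  #|[set i in T | x 0%R i != 0%R]|.

Lemma wt_onE (F : finFieldType) (n : nat) (T : {set 'I_n}) (x : 'rV[F]_n) :
  wt_on T x = \sum_(i in T) (x 0%R i != 0%R).
Proof.
rewrite /wt_on -sum1dep_card big_mkcondr /=.
by apply: eq_bigr => i _; case: (x _ _ != _).
Qed.

(** Only [a = - x / y] makes the affine form vanish; the successor avoids a truncated [#|F| - 1]. *)
Lemma sum_affine_neq0 (F : finFieldType) (x y : F) : y != 0%R ->
  (\sum_(a : F) (x + a * y != 0)%R).+1 = #|F|.
Proof.
move=> y0; rewrite -[RHS]sum1_card (bigD1 (- x / y)%R) //= divfK // addrN eqxx.
rewrite [RHS](bigD1 (- x / y)%R) //=; congr _.+1; apply: eq_bigr => a a_neq.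
suff -> : (x + a * y != 0)%R by [].
by apply: contraNneq a_neq => /eqP; rewrite addrC addr_eq0 => /eqP <-; rewrite mulfK.
Qed.

Lemma wt_on_residual (F : finFieldType) (n : nat) (T : {set 'I_n})
    (c d : 'rV[F]_n) :
  (forall a : F, wt_on T (d + a *: c)%R <= wt_on T c) ->
  wt_on [set i in T | c 0%R i == 0%R] d <= wt_on T c %/ #|F|.
Proof.
set S := [set i in T | _] => le_c.
have q_gt0 : 0 < #|F| by apply/card_gt0P; exists 0%R.
rewrite leq_divRL //.
have sum_le : \sum_(a : F) wt_on T (d + a *: c)%R <= #|F| * wt_on T c.
  by rewrite -sum_nat_const; apply: leq_sum.
(* Adding [wt_on T c] raises the contribution of each coordinate in the support of [c] from [q - 1]
   to [q], so the double count becomes an identity without subtraction, checked coordinate by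
   coordinate. *)
suff sumE : \sum_(a : F) wt_on T (d + a *: c)%R + wt_on T c =
    wt_on S d * #|F| + #|F| * wt_on T c.
  by rewrite -(leq_add2r (#|F| * wt_on T c)) -sumE addnC leq_add2l.
under eq_bigr do rewrite wt_onE.
have -> : wt_on S d = \sum_(i in T) (c 0%R i == 0%R) * (d 0%R i != 0%R).
  rewrite wt_onE big_mkcond [RHS]big_mkcond; apply: eq_bigr => i _.
  by rewrite inE; case: (i \in T) => //=; case: (c _ _ == _); rewrite ?mul1n.
rewrite exchange_big /= wt_onE big_distrl big_distrr /=.
rewrite -!big_split; apply: eq_bigr => i _ /=.
under eq_bigr do rewrite !mxE.
case: (eqVneq (c 0%R i) 0%R) => [-> | ci0]; last first.
  by rewrite addn1 sum_affine_neq0 // muln1.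
under eq_bigr do rewrite mulr0 addr0.
by rewrite sum_nat_const muln0 !addn0 mul1n mulnC.
Qed.

(** Both [k] and [m] are mere upper bounds because the induction controls the residual code only by
    inequalities. *)
Lemma card_coords_le (F : finFieldType) (n k m : nat) (T : {set 'I_n})
    (V : {vspace 'rV[F]_n}) :
  \dim V <= k ->
  (forall i, i \in T -> exists2 c, c \in V & c 0%R i != 0%R) ->
  (forall c, c \in V -> wt_on T c <= m) ->
  #|T| <= \sum_(0 <= i < k) (m %/ #|F| ^ i).
Proof.
elim: k m T V => [|k IHk] m T V dimV supp le_m.
  rewrite big_geq // leqn0 cards_eq0; apply/set0Pn => -[i /supp [c cV]].
  move: dimV; rewrite leqn0 dimv_eq0 => /eqP V0.
  by move: cV; rewrite V0 memv0 => /eqP ->; rewrite mxE eqxx.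
case: (@arg_maxnP _ (0%R : 'rV[F]_n) (mem V) (wt_on T) (mem0v V)) => c cV c_max.
(* Splitting off a zero [c] would not lower the dimension. But then, by maximality, every word of
   [V] vanishes on [T], which forces [T] to be empty. *)
have [c0 | c_neq0] := eqVneq c 0%R.
  suff -> : T = set0 by rewrite cards0.
  apply/eqP/set0Pn => -[i iT]; have [d dV di] := supp i iT.
  have := c_max d dV; rewrite c0 /= [X in _ <= X]wt_onE big1 => [|j _];
    last by rewrite mxE eqxx.
  by rewrite leqNgt card_gt0; case/set0Pn; exists i; rewrite inE iT.
set S := [set i in T | c 0%R i == 0%R].
have cardT : #|T| = wt_on T c + #|S|.
  rewrite addnC -(cardsID [set i | c 0%R i == 0%R] T).
  by congr addn; apply: eq_card => i; rewrite !inE // andbC.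
have capE : (V :&: <[c]> = <[c]>)%VS by apply/capv_idPr; rewrite -memvE.
rewrite cardT big_nat_recl // expn0 divn1.
apply: leq_add; first exact: le_m.
under eq_bigr do rewrite expnS divnMA.
(* A complement of the line of [c] in [V] has dimension one less and, as [c] vanishes on [S], the
   same restrictions to [S] as [V]. *)
apply: (IHk _ _ (V :\: <[c]>)%VS).
- have := dimv_cap_compl V <[c]>; rewrite capE dim_vline c_neq0 add1n => dimE.
  by rewrite -ltnS dimE.
- move=> i; rewrite /S inE => /andP [iT /eqP ci]; have [d dV di] := supp i iT.
  move: dV; rewrite -{1}(addv_diff_cap V <[c]>) capE.
  case/memv_addP => e eV [_ /vlineP [a ->] dE]; exists e => //.
  by move: di; rewrite dE !mxE ci mulr0 addr0.
- move=> d /(subvP (diffvSl V <[c]>)) dV.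
  apply: leq_trans (leq_div2r _ (le_m c cV)).
  by apply: wt_on_residual => a; apply: c_max; apply: memvD => //; apply: memvZ.
Qed.

Lemma dual_dist2_supp (F : finFieldType) (n : nat) (C : {vspace 'rV[F]_n}) :
  min_dist_ge (dual_code C) 2 ->
  forall i, exists2 c, c \in C & c 0%R i != 0%R.
Proof.
move=> /min_dist_ge2P dual2 i.
have [/exists_inP // | no_c] := boolP [exists c in C, c 0%R i != 0%R].
(* If all codewords vanish at [i], the unit vector at [i] is a dual word of weight one. *)
case: (dual2 (delta_mx 0%R i)).
  rewrite inE; apply/forall_inP => c cC; rewrite (bigD1 i) //= big1 => [|j ji].
    have /exists_inPn /(_ c cC) /negbNE /eqP -> := no_c.
    by rewrite mulr0 addr0.
  by rewrite mxE (negPf ji) andbF mul0r.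
rewrite /wt -[RHS](cards1 i); apply: eq_card => j.
by rewrite !inE mxE eqxx /=; case: (j == i); rewrite ?oner_eq0 ?eqxx.
Qed.

Theorem theorem1p1 (F : finFieldType) (q n k : nat)
    (C : {vspace 'rV[F]_n}) :
  #|F| = q ->
  0 < n ->
  \dim C = k ->
  min_dist_ge (dual_code C) 2 ->
  n <= \sum_(0 <= i < k) (diameter C %/ q ^ i).
Proof.
move=> <- _ <- dual2; rewrite -[X in X <= _]card_ord -cardsT.
apply: (card_coords_le (leqnn _)) => [i _ | c cC]; first exact: dual_dist2_supp.
rewrite (_ : wt_on _ c = wt c); first exact: leq_bigmax_cond.
by apply: eq_card => i; rewrite !inE.
Qed.
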